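(* In the setting of the context, let $\sigma_n^{*2}$ be the optimal reverse variance at step $n\in\{1,\dots,N\}$. Then $$\lambda_n^2\le\sigma_n^{*2}\le\lambda_n^2+\Big(\sqrt{\tfrac{\overline{\beta}_n}{\alpha_n}}-\sqrt{\overline{\beta}_{n-1}-\lambda_n^2}\Big)^2.$$ If moreover $q(\mathbf{x}_0)$ is supported in $[a,b]^d$, then $$\sigma_n^{*2}\le\lambda_n^2+\Big(\sqrt{\overline{\alpha}_{n-1}}-\sqrt{\overline{\beta}_{n-1}-\lambda_n^2}\cdot\sqrt{\tfrac{\overline{\alpha}_n}{\overline{\beta}_n}}\Big)^2\Big(\frac{b-a}{2}\Big)^2.$$
   Context: Let $d,N\ge 1$. Let $\beta_1,\dots,\beta_N\in(0,1)$, $\alpha_n:=1-\beta_n$, $\overline{\alpha}_n:=\prod_{i=1}^n\alpha_i$, $\overline{\beta}_n:=1-\overline{\alpha}_n$, with $\overline{\alpha}_0:=1$, $\overline{\beta}_0:=0$. Let $\lambda_n\ge0$ with $\lambda_n^2\le\overline{\beta}_{n-1}$ (so $\lambda_1=0$). Let $q(\mathbf{x}_0)$ be a probability density on $\mathbb{R}^d$ with finite second moments. Define $\tilde{\boldsymbol{\mu}}_n(\mathbf{x}_n,\mathbf{x}_0):=\sqrt{\overline{\alpha}_{n-1}}\mathbf{x}_0+\sqrt{\overline{\beta}_{n-1}-\lambda_n^2}\,\frac{\mathbf{x}_n-\sqrt{\overline{\alpha}_n}\mathbf{x}_0}{\sqrt{\overline{\beta}_n}}$ and the forward process $q(\mathbf{x}_{0:N})=q(\mathbf{x}_0)q(\mathbf{x}_N|\mathbf{x}_0)\prod_{n=2}^Nq(\mathbf{x}_{n-1}|\mathbf{x}_n,\mathbf{x}_0)$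 with $q(\mathbf{x}_N|\mathbf{x}_0)=\mathcal{N}(\sqrt{\overline{\alpha}_N}\mathbf{x}_0,\overline{\beta}_N\mathbf{I})$ and $q(\mathbf{x}_{n-1}|\mathbf{x}_n,\mathbf{x}_0)=\mathcal{N}(\tilde{\boldsymbol{\mu}}_n(\mathbf{x}_n,\mathbf{x}_0),\lambda_n^2\mathbf{I})$. The reverse model is $p(\mathbf{x}_{0:N})=p(\mathbf{x}_N)\prod_{n=1}^Np(\mathbf{x}_{n-1}|\mathbf{x}_n)$, $p(\mathbf{x}_N)=\mathcal{N}(\mathbf{0},\mathbf{I})$, $p(\mathbf{x}_{n-1}|\mathbf{x}_n)=\mathcal{N}(\boldsymbol{\mu}_n(\mathbf{x}_n),\sigma_n^2\mathbf{I})$. The optimal reverse variances $\sigma_n^{*2}$ are the variances of a minimizer of $D_{\mathrm{KL}}(q(\mathbf{x}_{0:N})\|p(\mathbf{x}_{0:N}))$ over all $\{\boldsymbol{\mu}_n,\sigma_n^2\}_{n=1}^N$; they equal $\sigma_n^{*2}=\mathbb{E}_{q_n(\mathbf{x}_n)}\mathrm{tr}(\mathrm{Cov}_{q(\mathbf{x}_{n-1}|\mathbf{x}_n)}[\mathbf{x}_{n-1}])/d$, where $q_n$ is the marginal of $\mathbf{x}_n$. *)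

(* Defs.v *)
From HB Require Import structures.
From mathcomp Require Import all_boot all_order all_algebra.
From mathcomp Require Import all_classical all_reals all_analysis.
Set Implicit Arguments. Unset Strict Implicit. Unset Printing Implicit Defensive.
Import Order.TTheory GRing.Theory Num.Theory.
Local Open Scope classical_set_scope.
Local Open Scope ring_scope.

(** A copy of R^d (row vectors) carrying a pointed structure, used as the
    carrier of the Borel sigma-algebra on R^d. *)
Definition ptrV (R : realType) d := 'rV[R]_d.
HB.instance Definition _ R d := Choice.on (ptrV R d).
HB.instance Definition _ R d := isPointed.Build (ptrV R d) 0%R.

Section defs.
Variable R : realType.

Definition alpha (beta : nat -> R) (k : nat) : R := 1 - beta k.
Definition abar (beta : nat -> R) (n : nat) : R :=
  \prod_(1 <= i < n.+1) alpha beta i.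
Definition bbar (beta : nat -> R) (n : nat) : R := 1 - abar beta n.

Definition mutilde (beta lambda : nat -> R) d (n : nat)
    (xn x0 : 'rV[R]_d) : 'rV[R]_d :=
  Num.sqrt (abar beta n.-1) *: x0 +
  Num.sqrt (bbar beta n.-1 - lambda n ^+ 2) *:
    ((Num.sqrt (bbar beta n))^-1 *: (xn - Num.sqrt (abar beta n) *: x0)).

(** Reparametrised forward process, run backwards from x_N:
    x_N = sqrt(abar_N) x_0 + sqrt(bbar_N) w_N,
    x_{n-1} = mutilde_n(x_n, x_0) + lambda_n w_{n-1}   (n = N, ..., 2),
    with independent standard Gaussian noises w_1..w_N (independent of x_0).
    fwd_rev m computes x_{N-m}. *)
Fixpoint fwd_rev (beta lambda : nat -> R) d (N : nat) (x0 : 'rV[R]_d)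
    (w : nat -> 'rV[R]_d) (m : nat) : 'rV[R]_d :=
  match m with
  | 0 => Num.sqrt (abar beta N) *: x0 + Num.sqrt (bbar beta N) *: w N
  | m'.+1 => let n := (N - m')%N in
      mutilde beta lambda n (fwd_rev beta lambda N x0 w m') x0
      + lambda n *: w n.-1
  end.

Definition fwd (beta lambda : nat -> R) d (N : nat) (x0 : 'rV[R]_d)
    (w : nat -> 'rV[R]_d) (k : nat) : 'rV[R]_d :=
  if k == 0%N then x0 else fwd_rev beta lambda N x0 w (N - k).

(** Borel sigma-algebra on R^d: generated by coordinate half-spaces. *)
Definition halfspaces d : set (set (ptrV R d)) :=
  [set A | exists (i : 'I_d) (c : R), A = [set x : ptrV R d | x ord0 i <= c]].

Fixpoint iint (n : nat) : ('rV[R]_n -> \bar R) -> \bar R :=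
  match n return ('rV[R]_n -> \bar R) -> \bar R with
  | 0 => fun f => f 0
  | n'.+1 => fun f =>
      (\int[@lebesgue_measure R]_x
         iint (fun v : 'rV[R]_n' => f (row_mx (const_mx x : 'rV[R]_1) v)))%E
  end.

Definition is_cond_exp dT (T : measurableType dT) (P : probability T R) d
    (X Y : T -> 'rV[R]_d) (g : 'rV[R]_d -> 'rV[R]_d) : Prop :=
  @measurable_fun _ _ (g_sigma_algebraType (@halfspaces d)) (g_sigma_algebraType (@halfspaces d)) setT g /\
  (forall i, P.-integrable setT (fun t => (g (X t) ord0 i)%:E)) /\
  (forall A : set (g_sigma_algebraType (@halfspaces d)), measurable A -> forall i,
     (\int[P]_(t in X @^-1` A) (Y t ord0 i)%:E =
      \int[P]_(t in X @^-1` A) (g (X t) ord0 i)%:E)%E).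

(** E_{x_n} tr Cov[x_{n-1} | x_n] = E || Y - E[Y|X] ||^2, computed with the
    version g of the conditional expectation. *)
Definition exp_tr_cond_cov dT (T : measurableType dT) (P : probability T R) d
    (X Y : T -> 'rV[R]_d) (g : 'rV[R]_d -> 'rV[R]_d) : \bar R :=
  (\int[P]_t (\sum_(i < d) (Y t ord0 i - g (X t) ord0 i) ^+ 2)%:E)%E.

End defs.

Notation Rd R d := (g_sigma_algebraType (@halfspaces R d)).

(* Main.v *)
Require Import Defs.
From HB Require Import structures.
From mathcomp Require Import all_boot all_order all_algebra.
From mathcomp Require Import all_classical all_reals all_analysis.
From mathcomp Require Import measurable_realfun ring lra.
Set Implicit Arguments.
Unset Strict Implicit.
Unset Printing Implicit Defensive.
Import Order.TTheory GRing.Theory Num.Theory.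
Import numFieldNormedType.Exports.
Local Open Scope classical_set_scope.
Local Open Scope ring_scope.

(* In terms of the data and of the noises, [x_{n-1}] is
   [mutilde_n(x_n, x_0) + lambda_n w_{n-1}], where [w_{n-1}] is standard
   Gaussian and independent of [(x_0, x_n)]. Hence, for every function [Z] of
   [(x_0, x_n)], [E(x_{n-1} - Z)^2 = E(mutilde_n - Z)^2 + lambda_n^2]
   coordinatewise. With [Z = E[x_{n-1} | x_n]] this is the lower bound. The
   conditional expectation minimises the quadratic error, so any affine [Z] in
   [x_n] gives an upper bound: [Z = x_n / sqrt(alpha_n)] leaves a multiple of
   the residual [x_n - sqrt(abar_n) x_0], whose variance is [bbar_n], while
   the [Z] that replaces [x_0] by the centre of the box in [mutilde_n] leaves
   a multiple of [x_0 - (a + b) / 2]. *)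

(** * Moments of the standard normal distribution *)

(** [is_cond_exp] gives integrability of [g (x_n)], but not of its square, so a product such as
    [g (x_n) * w_{n-1}] cannot be integrated at the outset. The main estimates are therefore carried
    by integrals of nonnegative functions with values in the extended reals. Cross terms are
    disposed of by reflecting the Gaussian noise and, for the conditional expectation, by cutting
    the space into thin level sets. Independence is given only as a product formula on boxes, whose
    [x_0] factor is an iterated integral. That factor becomes an abstract function [F] of the box,
    compared between boxes but not computed. Since [x_n] is built from [x_0] and [w_n, ..., w_N],
    the sigma-algebras of these variables shrink as [n] grows, and [w_{n-1}] is independent of the
    one at [n]. The variance [bbar_n] of the residual is obtained by descending from [N] along this
    family. *)

Section normal_moments.
Context {R : realType}.
Local Notation mu := (@lebesgue_measure R).

(** The Radon-Nikodym derivative of [normal_prob] and [normal_pdf] have the same integral over every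
    measurable set, hence agree almost everywhere. *)
Lemma ge0_integral_normal_prob (m s : R) (f : R -> \bar R) :
  measurable_fun setT f -> (forall x, 0 <= f x)%E ->
  (\int[normal_prob m s]_x f x = \int[mu]_x (f x * (normal_pdf m s x)%:E))%E.
Proof.
move=> mf f0; have dom := normal_prob_dominates m s.
rewrite -(Radon_Nikodym_SigmaFinite.change_of_variables dom f0)//.
have ig := Radon_Nikodym_SigmaFinite.f_integrable dom.
have mphi : measurable_fun setT (fun x => (normal_pdf m s x)%:E).
  by apply/measurable_EFinP; exact: measurable_normal_pdf.
apply: ae_eq_integral => //.
- by apply: emeasurable_funM => //; exact: measurable_int ig.
- exact: emeasurable_funM.
apply: ae_eqe_mul2l; apply: integral_ae_eq => //.
by move=> E _ mE; rewrite -Radon_Nikodym_SigmaFinite.f_integral.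
Qed.

Local Notation phi := (@normal_pdf R 0 1).

Lemma std_normal_pdfE (x : R) :
  phi x = normal_peak 1 * expR (- (x ^+ 2 / 2)).
Proof.
rewrite normal_pdfE ?oner_eq0// /normal_fun subr0 expr1n.
by congr (_ * expR _); rewrite mulNr mulr2n.
Qed.

Lemma is_derive_mul_std_normal_pdf (x : R) :
  is_derive x 1 (fun y : R => y * phi y) ((1 - x ^+ 2) * phi x).
Proof.
have -> : (fun y : R => y * phi y) =
    (fun y => y * (normal_peak 1 * expR (- (y ^+ 2 / 2)))).
  by apply/funext => y; rewrite std_normal_pdfE.
apply: is_derive_eq.
rewrite std_normal_pdfE /GRing.scale/=.
have : (2 : R) != 0 by [].
by move=> h; field.
Qed.

Lemma cvg_mul_std_normal_pdf : x * phi x @[x --> +oo%R] --> (0 : R).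
Proof.
apply: (@squeeze_cvgr _ _ _ _ (cst 0) (fun x => (2 * normal_peak 1) * x^-1)).
- near=> x; have x0 : 0 < x by near: x; exact: nbhs_pinfty_gt.
  rewrite /cst std_normal_pdfE; apply/andP; split.
    by rewrite !mulr_ge0 ?normal_peak_ge0 ?expR_ge0 ?ltW.
  rewrite (_ : x * _ = normal_peak 1 * (x * expR (- (x ^+ 2 / 2)))); last by ring.
  rewrite (_ : 2 * _ / x = normal_peak 1 * (2 / x)); last by ring.
  apply: ler_wpM2l; first exact: normal_peak_ge0.
  (* The claim is now [x^2 <= 2 exp(x^2 / 2)], a consequence of [1 + u <= exp u] at
     [u = x^2 / 2]. *)
  rewrite expRN ler_pdivrMr ?expR_gt0// mulrAC ler_pdivlMr//.
  apply: (@le_trans _ _ (2 * (1 + x ^+ 2 / 2))); first by nra.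
  by rewrite ler_pM2l// expR_ge1Dx.
- exact: cvg_cst.
- rewrite -[X in _ --> X](mulr0 (2 * normal_peak (1 : R))).
  apply: cvgM; first exact: cvg_cst.
  by apply/gtr0_cvgV0; [exact: nbhs_pinfty_gt | exact: cvg_id].
Unshelve. all: by end_near. Qed.

Let cphi : continuous phi.
Proof. exact: continuous_normal_pdf (oner_neq0 _). Qed.

Let cxphi : continuous (fun x : R => x * phi x).
Proof. by move=> x; apply: cvgM; [exact: cvg_id | exact: cphi]. Qed.

Let c2phi : continuous (fun x : R => x ^+ 2 * phi x).
Proof. by move=> x; apply: cvgM; [exact: exprn_continuous | exact: cphi]. Qed.

Let c1phi : continuous (fun x : R => (1 - x ^+ 2) * phi x).
Proof.
move=> x; apply: cvgM; last exact: cphi.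
by apply: cvgB; [exact: cvg_cst | exact: exprn_continuous].
Qed.

Let dxphi (x : R) : derivable (fun x : R => x * phi x) x 1.
Proof. by have [] := is_derive_mul_std_normal_pdf x. Qed.

Let dxphiE (x : R) : derive1 (fun x : R => x * phi x) x = (1 - x ^+ 2) * phi x.
Proof.
by rewrite derive1E; apply: derive_val; exact: is_derive_mul_std_normal_pdf.
Qed.

Let phi0 (x : R) : 0 <= phi x. Proof. exact: normal_pdf_ge0. Qed.
Let phi20 (x : R) : 0 <= x ^+ 2 * phi x.
Proof. by rewrite mulr_ge0 ?sqr_ge0 ?phi0. Qed.

Let mE (f : R -> R) (D : set R) : continuous f -> measurable_fun D (EFin \o f).
Proof.
move=> cf; apply/measurable_EFinP/measurable_funTS.
exact: continuous_measurable_fun.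
Qed.

(* Integrating the derivative [(1 - x^2) phi(x)] of [x phi(x)] over [0, 1] and
   over [1, +oo[, where it has a constant sign, only involves nonnegative
   integrals. *)
Let half_second_moment : (\int[mu]_(x in `[0%R, +oo[) (x ^+ 2 * phi x)%:E =
                    \int[mu]_(x in `[0%R, +oo[) (phi x)%:E)%E.
Proof.
have I1 : (\int[mu]_(x in `[0%R, 1%R]) ((1 - x ^+ 2) * phi x)%:E =
    (phi 1)%:E)%E.
  rewrite (@continuous_FTC2 _ _ (fun x => x * phi x))//.
  - by rewrite mul1r mul0r sube0.
  - exact: continuous_subspaceT.
  - split; first by move=> x _; exact: dxphi.
      by apply: cvg_at_right_filter; exact: cxphi.
    by apply: cvg_at_left_filter; exact: cxphi.
have I2 : (\int[mu]_(x in `[1%R, +oo[) ((x ^+ 2 - 1) * phi x)%:E =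
    (phi 1)%:E)%E.
  rewrite (@ge0_continuous_FTC2y _ _ (fun x => - (x * phi x)) 1 0)//.
  - by rewrite mul1r EFinN sub0e oppeK.
  - by move=> x x1; rewrite mulr_ge0 ?phi0// subr_ge0 exprn_ege1.
  - apply: continuous_subspaceT => x.
    apply: cvgM; last exact: cphi.
    by apply: cvgB; [exact: exprn_continuous | exact: cvg_cst].
  - by rewrite -[X in _ --> X]oppr0; apply: cvgN; exact: cvg_mul_std_normal_pdf.
  - by move=> x _; apply: derivableN; exact: dxphi.
  - by apply: cvg_at_right_filter; apply: cvgN; exact: cxphi.
  - move=> x _; rewrite derive1E deriveN; last exact: dxphi.
    rewrite -derive1E dxphiE; ring.
have split01 (f : R -> R) : continuous f -> (forall x, 0 <= f x) ->
    (\int[mu]_(x in `[0%R, +oo[) (f x)%:E =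
     \int[mu]_(x in `[0%R, 1%R]) (f x)%:E +
     \int[mu]_(x in `[1%R, +oo[) (f x)%:E)%E.
  move=> cf f0.
  rewrite -(integral_itv_obnd_cbnd (r := 1)); last exact: mE.
  rewrite -ge0_integral_setU//=.
  - by rewrite -itv_bndbnd_setU// bnd_simp.
  - exact: mE.
  - by move=> x _; rewrite lee_fin.
  - rewrite disj_set2E; apply/eqP; rewrite -subset0 => x /= [].
    by rewrite !in_itv/= => /andP[_ h]; rewrite andbT ltNge h.
rewrite !split01//.
have -> : (\int[mu]_(x in `[0%R, 1%R]) (phi x)%:E =
    (phi 1)%:E + \int[mu]_(x in `[0%R, 1%R]) (x ^+ 2 * phi x)%:E)%E.
  rewrite -I1 -ge0_integralD//=.
  - by apply: eq_integral => x _; rewrite -EFinD; congr EFin; ring.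
  - move=> x; rewrite in_itv/= => /andP[x0 x1]; rewrite lee_fin mulr_ge0//.
    by rewrite subr_ge0 exprn_ile1.
  - exact: mE.
  - by move=> x _; rewrite lee_fin.
  - exact: mE.
have -> : (\int[mu]_(x in `[1%R, +oo[) (x ^+ 2 * phi x)%:E =
    (phi 1)%:E + \int[mu]_(x in `[1%R, +oo[) (phi x)%:E)%E.
  rewrite -I2 -ge0_integralD//=.
  - by apply: eq_integral => x _; rewrite -EFinD; congr EFin; ring.
  - move=> x; rewrite in_itv/= andbT => x1; rewrite lee_fin mulr_ge0//.
    by rewrite subr_ge0 exprn_ege1.
  - apply: (@mE (fun x => (x ^+ 2 - 1) * phi x)) => x.
    apply: cvgM; last exact: cphi.
    by apply: cvgB; [exact: exprn_continuous | exact: cvg_cst].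
  - by move=> x _; rewrite lee_fin.
  - exact: mE.
by rewrite addeCA addeA.
Qed.

(** Both [phi] and [x ^+ 2 * phi x] are even, so their equality on the half-line extends to the
    whole line, where [phi] has mass one. *)
Lemma std_normal_second_moment :
  (\int[mu]_x (x ^+ 2 * phi x)%:E = 1)%E.
Proof.
have phiN x : phi x = phi (- x) by rewrite !std_normal_pdfE sqrrN.
rewrite ge0_symfun_integralT//; last first.
  by move=> x /=; rewrite sqrrN -phiN.
have -> : [set x : R | 0 <= x] = `[0%R, +oo[%classic by rewrite -set_itvcy.
rewrite half_second_moment -(integral_normal_pdf (0 : R) 1).
rewrite ge0_symfun_integralT//.
by have -> : [set x : R | 0 <= x] = `[0%R, +oo[%classic by rewrite -set_itvcy.
Qed.

(** Reflection gives [I (- l) = I l], and in the sum of the two integrands the terms linear in [y]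
    cancel pointwise. Only nonnegative integrands are left. *)
Lemma integral_sqr_affine_normal (a l : R) :
  (\int[normal_prob 0 1]_y ((a + l * y) ^+ 2)%:E = (a ^+ 2 + l ^+ 2)%:E)%E.
Proof.
have mq (c : R) : continuous (fun y : R => (a + c * y) ^+ 2).
  move=> x; apply: (@continuous_comp _ _ _ (fun y : R => a + c * y) (fun z => z ^+ 2)); last exact: exprn_continuous.
  by apply: cvgD; [exact: cvg_cst | apply: cvgM; [exact: cvg_cst | exact: cvg_id]].
pose I (c : R) := (\int[mu]_y ((a + c * y) ^+ 2 * phi y)%:E)%E.
have IE c : (\int[normal_prob 0 1]_y ((a + c * y) ^+ 2)%:E = I c)%E.
  rewrite ge0_integral_normal_prob//; first exact: mE (mq c).
  by move=> y; rewrite lee_fin sqr_ge0.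
have c2 (c : R) : continuous (fun y => (a + c * y) ^+ 2 * phi y).
  by move=> x; apply: cvgM; [exact: mq | exact: cphi].
have p2 (c : R) y : 0 <= (a + c * y) ^+ 2 * phi y by rewrite mulr_ge0 ?sqr_ge0.
have IN : I (- l) = I l.
  rewrite /I; transitivity (\int[mu]_y ((fun z => ((a + l * z) ^+ 2 * phi z)%:E) (- y)%R))%E.
    apply: eq_integral => y _; rewrite /= mulNr mulrN; congr (_ * _)%:E.
    by rewrite !std_normal_pdfE sqrrN.
  transitivity (\int[pushforward mu (-%R : R -> measurableTypeR R)]_y ((a + l * y) ^+ 2 * phi y)%:E)%E.
    rewrite ge0_integral_pushforward//=; first exact: mE (c2 l).
    by move=> y _; rewrite lee_fin.
  by apply: eq_measure_integral => //= A mA _; exact: lebesgue_measureN.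
have Z (c : R) (f : R -> R) : 0 <= c -> continuous f -> (forall y, 0 <= f y) ->
    (\int[mu]_y (c%:E * (f y)%:E) = c%:E * \int[mu]_y (f y)%:E)%E.
  move=> c0 cf f0; apply: ge0_integralZl_EFin => //.
    by move=> y _; rewrite lee_fin.
  exact: mE.
have S : (I l + I (- l)%R = (2 * (a ^+ 2 + l ^+ 2))%:E)%E.
  rewrite /I -ge0_integralD//=.
  - transitivity (\int[mu]_y ((2 * a ^+ 2)%:E * (phi y)%:E
                   + (2 * l ^+ 2)%:E * (y ^+ 2 * phi y)%:E))%E.
      by apply: eq_integral => y _; rewrite -!EFinM -!EFinD; congr EFin; ring.
    rewrite ge0_integralD//=.
    + rewrite !Z//; last 2 first.
      * by rewrite mulr_ge0 ?sqr_ge0.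
      * by rewrite mulr_ge0 ?sqr_ge0.
      rewrite integral_normal_pdf std_normal_second_moment !mule1 -EFinD.
      by rewrite mulrDr.
    + move=> y _; apply: mule_ge0; rewrite lee_fin ?phi0 ?phi20//.
      by rewrite mulr_ge0 ?sqr_ge0.
    + by apply: emeasurable_funM => //; exact: mE.
    + move=> y _; apply: mule_ge0; rewrite lee_fin ?phi0 ?phi20//.
      by rewrite mulr_ge0 ?sqr_ge0.
    + by apply: emeasurable_funM => //; exact: mE.
  - by move=> y _; rewrite lee_fin.
  - exact: mE (c2 l).
  - by move=> y _; rewrite lee_fin.
  - exact: mE (c2 (- l)).
rewrite IE; move: S; rewrite IN.
(* An infinite [I l] would contradict the finite value in [S]. *)
case: (I l) => [r| |]//; rewrite -EFinD => -[] rE; congr EFin; lra.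
Qed.

End normal_moments.

(** * Independence *)

Section independence.
Context {R : realType} d (T : measurableType d) (P : probability T R).
Context (G : set (set T)) (g : (set T)^nat).
Hypothesis Gm : G `<=` measurable.
Hypothesis GI : setI_closed G.
Hypothesis Gg : forall i, G (g i).
Hypothesis g_cover : \bigcup_k g k = setT.
Context (w : T -> R) (nu : probability (measurableTypeR R) R).
Hypothesis mw : measurable_fun setT w.
Hypothesis Gw : forall B c, G B ->
  P (B `&` [set t | w t <= c]) = (P B * nu `]-oo, c]%classic)%E.

(** Uniqueness of finite measures agreeing on a pi-system, used twice: in [C] over rays with the
    generator [B'] fixed, then in [B] over [G] with [C] fixed. *)
Lemma indep_sigma_algebra (B : set T) (C : set (measurableTypeR R)) :
  <<s G >> B -> measurable C -> P (B `&` w @^-1` C) = (P B * nu C)%E.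
Proof.
move=> sB mC.
have mwC (C' : set (measurableTypeR R)) : measurable C' -> measurable (w @^-1` C').
  by move=> mC'; rewrite -[X in measurable X]setTI; exact: mw.
have PE (A : set T) : measurable A -> (P A = (fine (P A))%:E)%E.
  by move=> mA; rewrite fineK// fin_num_measure.
have P0 (A : set T) : 0 <= fine (P A) by rewrite fine_ge0.
have step1 (B' : set T) : G B' -> P (B' `&` w @^-1` C) = (P B' * nu C)%E.
  move=> GB'; have mB' := Gm GB'.
  pose m1 := pushforward (mrestr P mB') (w : T -> measurableTypeR R).
  pose m2 := mscale (NngNum (P0 B')) nu.
  have /(_ C) : forall E, <<s @RGenOInfty.G R >> E -> m1 E = m2 E; last first.
    rewrite /m1 /m2 /pushforward /mrestr /mscale/= -PE// setIC; apply.
    by rewrite -[X in X C](@RGenOInfty.measurableE R).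
  apply: (@g_sigma_algebra_measure_unique _ _ (measurableTypeR R) (@RGenOInfty.G R) _
     (fun n => `]- n%:R, +oo[%classic)).
  - by move=> _ [x ->]; exact: measurable_itv.
  - by move=> n; exists (- n%:R).
  - apply/seteqP; split => // x _; exists (Num.truncn `|x|).+1 => //=.
    rewrite in_itv/= andbT ltrNl (le_lt_trans (ler_norm _))// normrN.
    by rewrite truncnS_gt.
  - move=> _ _ [x ->] [y ->]; exists (Num.max x y).
    by apply/seteqP; split => z /=; rewrite !in_itv/= !andbT gt_max => /andP.
  - move=> _ [x ->].
    change (P (w @^-1` `]x, +oo[ `&` B') =
            (fine (P B'))%:E * nu `]x, +oo[%classic)%E.
    rewrite -PE//.
    (* The generating rays are open upper ones, while [Gw] speaks of closed lower ones; complements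
       translate between them. *)
    have -> : w @^-1` `]x, +oo[ `&` B' = B' `\` (B' `&` [set t | w t <= x]).
      apply/seteqP; split => t /=; rewrite in_itv/= andbT.
        by move=> [xw Bt]; split => // -[_]; rewrite leNgt xw.
      by move=> [Bt] /not_andP[//|/negP]; rewrite -ltNge.
    have mle : measurable [set t | w t <= x].
      by have := mwC _ (measurable_itv `]-oo, x]); rewrite preimage_itvNyc.
    rewrite measureD//; last 2 first.
    - exact: measurableI.
    - by rewrite ltey_eq fin_num_measure.
    rewrite setIA setIid. rewrite [X in (_ - X)%E](Gw x GB').
    have -> : (nu `]x, +oo[%classic = 1 - nu `]-oo, x]%classic)%E.
      by rewrite -setCitvl probability_setC.
    have nf : nu `]-oo, x]%classic \is a fin_num by rewrite fin_num_measure.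
    by rewrite muleBr ?mule1//; rewrite ?fin_num_measure// fin_num_adde_defr.
  - move=> k; change (P (w @^-1` `](- k%:R)%R, +oo[ `&` B') < +oo)%E.
    rewrite ltey_eq fin_num_measure//.
    by apply: measurableI => //; apply: mwC.
pose m1 := mrestr P (mwC _ mC).
have nuC0 : 0 <= fine (nu C) by rewrite fine_ge0.
pose m2 := mscale (NngNum nuC0) P.
have /(_ _ sB) : forall E, <<s G >> E -> m1 E = m2 E; last first.
  by rewrite /m1 /m2 /mrestr /mscale/= fineK ?fin_num_measure// muleC.
apply: (@g_sigma_algebra_measure_unique _ _ _ G Gm g Gg g_cover _ _ GI).
- move=> E GE.
  change (P (E `&` w @^-1` C) = (fine (nu C))%:E * P E)%E.
  by rewrite fineK ?fin_num_measure// muleC step1.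
- move=> k; change (P (g k `&` w @^-1` C) < +oo)%E.
  rewrite ltey_eq fin_num_measure//.
  by apply: measurableI; [exact: Gm | exact: (mwC _ mC)].
Qed.

Lemma sub_sigma_algebra_measurable (A : set T) : <<s G >> A -> measurable A.
Proof. by apply: smallest_sub => //; exact: sigma_algebra_measurable. Qed.

Lemma sub_sigma_algebra_measurable_fun (A : g_sigma_algebraType G -> R) :
  measurable_fun setT A -> measurable_fun setT (A : T -> R).
Proof.
move=> mA _ Y mY; apply: sub_sigma_algebra_measurable.
exact: mA.
Qed.

(** Independence identifies the law of [(A, w)] with a product measure, since the two agree on
    rectangles; Tonelli then integrates [w] out. *)
Lemma indep_integral (A : g_sigma_algebraType G -> R) (f : R * R -> \bar R) :
  measurable_fun setT A -> measurable_fun setT f -> (forall x, 0 <= f x)%E ->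
  (\int[P]_t f (A t, w t) = \int[P]_t \int[nu]_y f (A t, y))%E.
Proof.
move=> mA mf f0; have mAT := sub_sigma_algebra_measurable_fun mA.
pose A' : T -> measurableTypeR R := A.
pose J : T -> measurableTypeR R * measurableTypeR R := fun t => (A' t, w t).
have mJ : measurable_fun setT J by exact/measurable_fun_pair.
have mA' : measurable_fun setT A' by [].
have mf' : measurable_fun setT (f : measurableTypeR R * measurableTypeR R -> \bar R) by exact: mf.
transitivity (\int[pushforward P J]_z f z)%E.
  by rewrite ge0_integral_pushforward.
pose A1 : {mfun T >-> measurableTypeR R} := mfun_Sub (mem_set mA').
transitivity (\int[distribution P A1 \x nu]_z f z)%E.
  apply: eq_measure_integral => /= S mS _; apply/esym.
  apply: product_measure_unique => //= S1 S2 mS1 mS2.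
  rewrite /pushforward/=.
  rewrite -indep_sigma_algebra//.
  by rewrite -[X in <<s G >> X]setTI; exact: mA.
rewrite fubini_tonelli1//.
rewrite ge0_integral_pushforward//.
- exact: measurable_fun_fubini_tonelli_F.
- by move=> x _; apply: integral_ge0.
Qed.

End independence.

(** * Conditional expectation as a best approximation *)

Section conditional_expectation_projection.
Context {R : realType} d (T : measurableType d) (P : probability T R).
Context (U D : T -> R).
Hypothesis iU : P.-integrable setT (EFin \o U).
Hypothesis iD : P.-integrable setT (EFin \o D).
Hypothesis UD : forall S : set R, measurable S ->
  (\int[P]_(t in D @^-1` S) (U t)%:E = \int[P]_(t in D @^-1` S) (D t)%:E)%E.

Let V (t : T) := U t - D t.

Let mU : measurable_fun setT U.
Proof. by apply/measurable_EFinP; exact: measurable_int iU. Qed.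
Let mD : measurable_fun setT D.
Proof. by apply/measurable_EFinP; exact: measurable_int iD. Qed.
Let mV : measurable_fun setT V.
Proof. exact: measurable_funB. Qed.
Let iV : P.-integrable setT (EFin \o V).
Proof.
rewrite (_ : _ \o _ = (EFin \o U) \- (EFin \o D))%E; first exact: integrableB.
by apply/funext => t.
Qed.
Let mpre (S : set R) : measurable S -> measurable (D @^-1` S).
Proof. by move=> mS; rewrite -[X in measurable X]setTI; exact: mD. Qed.

Let intV (S : set R) : measurable S ->
  (\int[P]_(t in D @^-1` S) (V t)%:E = 0)%E.
Proof.
move=> mS; have mDS := mpre mS.
have iUS : P.-integrable (D @^-1` S) (EFin \o U) by exact: integrableS iU.
have iDS : P.-integrable (D @^-1` S) (EFin \o D) by exact: integrableS iD.
transitivity (\int[P]_(t in D @^-1` S) ((EFin \o U) \- (EFin \o D)) t)%E.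
  by apply: eq_integral => t _.
rewrite integralB// UD// subee//.
exact: integrable_fin_num.
Qed.

Let mW e : measurable_fun setT (fun t => (U t ^+ 2 + 2 * e * `|V t|)%:E).
Proof.
apply/measurable_EFinP; apply: measurable_funD; first exact: measurable_funX.
by apply: measurable_funM => //; exact: measurableT_comp.
Qed.
Let mV2 : measurable_fun setT (fun t => (V t ^+ 2)%:E).
Proof. by apply/measurable_EFinP; exact: measurable_funX. Qed.

(* On a set where [r <= D <= r + e] one has
   [V^2 + 2 r V <= U^2 + 2 e |V|], and [V = U - D] integrates to [0] there.
   No integrability of [D^2] is needed, and [e] is sent to [0] at the end. *)
Let slice (e r : R) (S : set R) : 0 < e -> measurable S ->
    (forall x, S x -> r <= x <= r + e) ->
  (\int[P]_(t in D @^-1` S) (V t ^+ 2)%:E <=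
   \int[P]_(t in D @^-1` S) (U t ^+ 2 + 2 * e * `|V t|)%:E)%E.
Proof.
move=> e0 mS Sr; have mDS := mpre mS.
set W := fun t => (U t ^+ 2 + 2 * e * `|V t|)%:E.
have W0 t : (0 <= W t)%E.
  by rewrite lee_fin addr_ge0 ?sqr_ge0// mulr_ge0// mulr_ge0// ltW.
have mWS : measurable_fun (D @^-1` S) W by apply: measurable_funTS; exact: mW.
have [->|Wfin] := eqVneq (\int[P]_(t in D @^-1` S) W t)%E +oo%E.
  by rewrite leey.
have iW : P.-integrable (D @^-1` S) W.
  apply/integrableP; split => //.
  under eq_integral do rewrite gee0_abs//.
  by rewrite ltey.
have i2V : P.-integrable (D @^-1` S) (fun t => (2 * r)%:E * (V t)%:E)%E.
  by apply: integrableZl => //; exact: integrableS iV.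
have -> : (\int[P]_(t in D @^-1` S) W t =
    \int[P]_(t in D @^-1` S) (W t - (2 * r)%:E * (V t)%:E))%E.
  rewrite integralB// integralZl//; last exact: integrableS iV.
  by rewrite intV// mule0 sube0.
apply: ge0_le_integral => //.
- by move=> t _; rewrite lee_fin sqr_ge0.
- exact: measurable_funTS.
- apply: emeasurable_funB; first exact: mWS.
  exact: measurable_int i2V.
move=> t /Sr/andP[rD Dr]; rewrite /W -EFinM -EFinB lee_fin.
have -> : U t = V t + D t by rewrite /V subrK.
have : `|V t * (D t - r)| <= `|V t| * e.
  rewrite normrM ler_wpM2l// ger0_norm ?subr_ge0//.
  by rewrite lerBlDl.
rewrite ler_norml => /andP[h _].
have := sqr_ge0 (D t) => h2.
rewrite -subr_ge0 (_ : _ - _ = D t ^+ 2 + 2 * (V t * (D t - r) - - (`|V t| * e))).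
  by rewrite addr_ge0// mulr_ge0// subr_ge0.
by ring.
Qed.

Let approx (e : R) : 0 < e ->
  (\int[P]_t (V t ^+ 2)%:E <=
   \int[P]_t (U t ^+ 2)%:E + (2 * e)%:E * \int[P]_t `|(V t)%:E|)%E.
Proof.
move=> e0.
(* The slices [[z e, (z + 1) e[], for [z] an integer, renumbered by naturals through [pickle]; an
   index that codes no integer gives the empty set. *)
pose S j := [set x : R | pickle (Num.floor (x / e)) = j].
have mS j : measurable (S j).
  have [->|/set0P[x0 Sx0]] := eqVneq (S j) set0; first by [].
  have -> : S j = `[(Num.floor (x0 / e))%:~R * e, ((Num.floor (x0 / e) + 1)%:~R) * e[%classic.
    apply/seteqP; split => x /=; rewrite in_itv/= -ler_pdivlMr// -ltr_pdivrMr//.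
      move: Sx0; rewrite /S/= => <- /(pcan_inj pickleK) <-.
      by rewrite floor_le floorD1_gt.
    by move=> /floor_def fx; rewrite /S/= fx; exact: Sx0.
  exact: measurable_itv.
have cov : \bigcup_j (D @^-1` S j) = setT.
  by apply/seteqP; split => // t _; exists (pickle (Num.floor (D t / e))).
have triv : trivIset setT (fun j => D @^-1` S j).
  by apply/trivIsetP => i j _ _ ij; apply/seteqP; split => // t [/= ei ej];
    case/eqP: ij; rewrite -ei -ej.
have mDS j : measurable (D @^-1` S j) by exact: mpre.
have W0 t : (0 <= (U t ^+ 2 + 2 * e * `|V t|)%:E)%E.
  by rewrite lee_fin addr_ge0 ?sqr_ge0// mulr_ge0// mulr_ge0// ltW.
apply: (@le_trans _ _ (\int[P]_t (U t ^+ 2 + 2 * e * `|V t|)%:E)%E).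
  rewrite -cov !ge0_integral_bigcup//; last 3 first.
  - exact: measurable_funTS.
  - exact: measurable_funTS.
  - by move=> t _; rewrite lee_fin sqr_ge0.
  apply: lee_nneseries => [j _ _|j _].
    by apply: integral_ge0 => t _; rewrite lee_fin sqr_ge0.
  have [Sj0|/set0P[x0 Sx0]] := eqVneq (S j) set0.
    by rewrite Sj0 preimage_set0 !integral_set0.
  apply: (@slice e ((Num.floor (x0 / e))%:~R * e)) => // x Sx.
  have <- : Num.floor (x / e) = Num.floor (x0 / e).
    by apply: (pcan_inj pickleK); rewrite [LHS]Sx [RHS]Sx0.
  rewrite -[X in _ <= _ <= _ + X]mul1r -mulrDl; apply/andP; split.
    by rewrite -ler_pdivlMr// floor_le.
  rewrite -ler_pdivrMr//; apply/ltW.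
  by have := floorD1_gt (x / e); rewrite intrD.
under eq_integral do rewrite EFinD.
rewrite ge0_integralD//; last 4 first.
- by move=> t _; rewrite lee_fin sqr_ge0.
- by apply/measurable_EFinP; exact: measurable_funX.
- by move=> t _; rewrite lee_fin mulr_ge0// mulr_ge0// ltW.
- apply/measurable_EFinP; apply: measurable_funM => //.
  exact: measurableT_comp.
under [X in (_ + X <= _)%E]eq_integral do rewrite EFinM.
rewrite ge0_integralZl_EFin//; last 2 first.
- by apply/measurable_EFinP; exact: measurableT_comp.
- by rewrite mulr_ge0// ltW.
Qed.

(** By [UD], [D] is a version of the conditional expectation of [U] given [D]. In the application
    [U = Y - h] and [D = g (X) - h] for a competitor [h], so [U - D] is the error of [g] and [U]
    that of [h]. *)
Lemma cond_exp_projection :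
  (\int[P]_t ((U t - D t) ^+ 2)%:E <= \int[P]_t (U t ^+ 2)%:E)%E.
Proof.
set I := (\int[P]_t `|(V t)%:E|)%E.
have Ifin : I \is a fin_num by apply: integrable_fin_num => //; exact: integrable_abse.
have I0 : 0 <= fine I by rewrite fine_ge0// integral_ge0.
apply/lee_addgt0Pr => e e0.
(* Chosen so that [2 c I = e I / (I + 1) <= e]; the added [1] covers [I = 0]. *)
pose c := e / (2 * (fine I + 1)).
have c0 : 0 < c by rewrite divr_gt0// mulr_gt0// ltr_wpDl.
apply: (le_trans (approx c0)); apply: leeD => //.
rewrite -/I -(fineK Ifin) -EFinM lee_fin /c.
have I1 : 0 < fine I + 1 by rewrite ltr_wpDl.
rewrite (_ : 2 * _ * _ = e * fine I / (fine I + 1)); last first.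
  by field; rewrite gt_eqF.
by rewrite ler_pdivrMr// ler_pM2l// lerDl.
Qed.

End conditional_expectation_projection.

(** * The sigma-algebras of the noises *)

Lemma measurable_fun_le_rays {R : realType} d (T : measurableType d) (f : T -> R) :
  (forall y, measurable [set t | f t <= y]) -> measurable_fun setT f.
Proof.
move=> Hf; apply: (@measurability _ _ _ _ _ f (@RGenOInfty.G R)).
  exact: (@RGenOInfty.measurableE R).
move=> _ [_ [x ->] <-]; rewrite setTI.
have -> : f @^-1` `]x, +oo[ = ~` [set t | f t <= x].
  apply/seteqP; split => t /=; rewrite in_itv/= andbT.
    by move=> xf; apply/negP; rewrite -ltNge.
  by move=> /negP; rewrite -ltNge.
exact: measurableC.
Qed.

Section gaussian_noises.
Context {R : realType} (d N : nat) dT (T : measurableType dT).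
Context (P : probability T R) (X0 : T -> 'rV[R]_d) (W : nat -> T -> 'rV[R]_d).
Context (F : ('I_d -> R) -> ('I_d -> R) -> \bar R).
Local Notation Phi y := (normal_prob (0 : R) 1 `]-oo, y]%classic).

(** [noise_box 1] is the event of the joint law. A larger [m] forgets [w_1, ..., w_{m-1}], the
    noises that the backward recursion has not yet used at time [m]. *)
Definition noise_box (m : nat) (a b : 'I_d -> R) (c : nat -> 'I_d -> R) : set T :=
  [set t | (forall i, a i <= X0 t ord0 i <= b i) /\
           (forall k i, (m <= k <= N)%N -> W k t ord0 i <= c k i)].

(* A pi-system generating the sigma-algebra of [X0, W m, ..., W N]. *)
Definition noise_boxes (m : nat) : set (set T) :=
  [set B | exists a b c, B = noise_box m a b c].

Hypothesis mX0 : forall i, measurable_fun setT (fun t => X0 t ord0 i).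
Hypothesis mW : forall k i, measurable_fun setT (fun t => W k t ord0 i).
Hypothesis law : forall a b c, P (noise_box 1 a b c) =
  (F a b * \prod_(1 <= k < N.+1) \prod_(i < d) Phi (c k i))%E.

Lemma measurable_noise_box m a b c : measurable (noise_box m a b c).
Proof.
have -> : noise_box m a b c =
    (\bigcap_(i in [set: 'I_d]) ((fun t => X0 t ord0 i) @^-1` `[a i, b i])) `&`
    (\bigcap_(k in [set k | (m <= k <= N)%N]) \bigcap_(i in [set: 'I_d])
      ((fun t => W k t ord0 i) @^-1` `]-oo, c k i])).
  apply/seteqP; split => t /=.
    move=> [h1 h2]; split; first by move=> i _ /=; rewrite in_itv/= h1.
    by move=> k kN i _ /=; rewrite in_itv/= h2.
  move=> [h1 h2]; split; first by move=> i; have := h1 i I; rewrite /= in_itv.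
  by move=> k i kN; have := h2 k kN i I; rewrite /= in_itv.
apply: measurableI.
  apply: fin_bigcap_measurable; first exact: finite_finset.
  by move=> i _; rewrite -[X in measurable X]setTI; exact: mX0.
apply: bigcap_measurableType => k _.
apply: fin_bigcap_measurable; first exact: finite_finset.
by move=> i _; rewrite -[X in measurable X]setTI; exact: mW.
Qed.

Lemma noise_boxes_measurable m : noise_boxes m `<=` measurable.
Proof. by move=> _ [a [b [c ->]]]; exact: measurable_noise_box. Qed.

Lemma noise_boxes_setI m : setI_closed (noise_boxes m).
Proof.
move=> _ _ [a [b [c ->]]] [a' [b' [c' ->]]].
exists (fun i => Num.max (a i) (a' i)), (fun i => Num.min (b i) (b' i)),
  (fun k i => Num.min (c k i) (c' k i)).
apply/seteqP; split => t.
  move=> [[h1 h2] [h1' h2']]; split.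
    move=> i; rewrite ge_max le_min.
    by have /andP[-> ->] := h1 i; have /andP[-> ->] := h1' i.
  by move=> k i kN; rewrite le_min h2// h2'.
move=> [h1 h2]; split; split => [i|k i kN].
- by have := h1 i; rewrite ge_max le_min => /andP[/andP[-> _] /andP[-> _]].
- by have := h2 k i kN; rewrite le_min => /andP[].
- by have := h1 i; rewrite ge_max le_min => /andP[/andP[_ ->] /andP[_ ->]].
- by have := h2 k i kN; rewrite le_min => /andP[].
Qed.

Lemma noise_bound t : exists M : nat, (forall i, `|X0 t ord0 i| <= M%:R) /\
  (forall k i, (k <= N)%N -> `|W k t ord0 i| <= M%:R).
Proof.
pose s := \sum_(i < d) `|X0 t ord0 i| + \sum_(k < N.+1) \sum_(i < d) `|W k t ord0 i|.
have s1 : 0 <= \sum_(i < d) `|X0 t ord0 i| by apply: sumr_ge0.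
have s2 : 0 <= \sum_(k < N.+1) \sum_(i < d) `|W k t ord0 i|.
  by apply: sumr_ge0 => k _; apply: sumr_ge0.
have sM : s <= (Num.truncn s).+1%:R by apply/ltW; exact: truncnS_gt.
exists (Num.truncn s).+1; split.
  move=> i; apply: le_trans sM; rewrite /s (bigD1 i)//= -addrA lerDl.
  by rewrite addr_ge0// sumr_ge0.
move=> k i kN; apply: le_trans sM.
apply: (@le_trans _ _ (\sum_(j < d) `|W k t ord0 j|)).
  by rewrite (bigD1 i)//= lerDl sumr_ge0.
rewrite /s (bigD1 (Ordinal (kN : (k < N.+1)%N)))//= addrCA lerDl addr_ge0//.
by apply: sumr_ge0 => j _; exact: sumr_ge0.
Qed.

Definition noise_cube m (M : nat) : set T :=
  noise_box m (fun=> - M%:R) (fun=> M%:R) (fun _ _ => M%:R).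

Lemma noise_cube_cover m : \bigcup_M noise_cube m M = setT.
Proof.
apply/seteqP; split => // t _; have [M [h1 h2]] := noise_bound t.
exists M => //; split => [i|k i /andP[_ kN]]; first by rewrite -ler_norml.
exact: le_trans (ler_norm _) (h2 _ _ kN).
Qed.

Lemma noise_boxes_cube m M : noise_boxes m (noise_cube m M).
Proof. by do 3 eexists. Qed.

Local Notation noise_alg m := (g_sigma_algebraType (noise_boxes m)).

(** A half-space is not a box, but it is the countable union of the boxes whose remaining bounds are
    [M]. *)
Lemma noise_alg_X0 m i :
  measurable_fun setT (fun t : noise_alg m => X0 t ord0 i).
Proof.
apply: measurable_fun_le_rays => y.
have -> : [set t | X0 t ord0 i <= y] =
    \bigcup_M noise_box m (fun=> - M%:R)
      (fun j => if j == i then y else M%:R) (fun _ _ => M%:R).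
  apply/seteqP; split => t /=; last first.
    by move=> [M _ [h _]]; have := h i; rewrite eqxx => /andP[].
  move=> ty; have [M [h1 h2]] := noise_bound t.
  exists M => //; split => [j|k j /andP[_ kN]].
    have := h1 j; rewrite ler_norml => /andP[-> tM] /=.
    by case: eqP => // ->.
  exact: le_trans (ler_norm _) (h2 _ _ kN).
apply: sigma_algebra_bigcup => M; apply: sub_sigma_algebra.
by do 3 eexists.
Qed.

Lemma noise_alg_W m k i : (m <= k <= N)%N ->
  measurable_fun setT (fun t : noise_alg m => W k t ord0 i).
Proof.
move=> mkN; apply: measurable_fun_le_rays => y.
have -> : [set t | W k t ord0 i <= y] =
    \bigcup_M noise_box m (fun=> - M%:R) (fun=> M%:R)
      (fun l j => if (l == k) && (j == i) then y else M%:R).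
  apply/seteqP; split => t /=; last first.
    by move=> [M _ [_ h]]; have := h k i mkN; rewrite !eqxx.
  move=> ty; have [M [h1 h2]] := noise_bound t.
  exists M => //; split => [j|l j /andP[_ lN]]; first by rewrite -ler_norml.
  case: ifPn => [/andP[/eqP-> /eqP->]//|_].
  exact: le_trans (ler_norm _) (h2 _ _ lN).
apply: sigma_algebra_bigcup => M; apply: sub_sigma_algebra.
by do 3 eexists.
Qed.

Lemma cvg_Phi : (Phi (M%:R : R)) @[M --> \oo] --> (1 : \bar R)%E.
Proof.
rewrite -(@probability_setT _ _ _ (normal_prob (0 : R) 1)).
have -> : setT = \bigcup_M `]-oo, (M%:R : R)]%classic :> set R.
  apply/seteqP; split => // x _; exists (Num.truncn x).+1 => //=.
  by rewrite in_itv/= ltW// truncnS_gt.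
apply: nondecreasing_cvg_mu.
- by move=> M; exact: measurable_itv.
- by apply: bigcupT_measurable => M; exact: measurable_itv.
- move=> M M' MM'; apply/subsetPset => x /=; rewrite !in_itv/= => h.
  by rewrite (le_trans h)// ler_nat.
Qed.

(** The law bounds every noise, whereas this event leaves free those below [m] and the other
    coordinates of [W m]. The free ones receive the bound [M], and [PSS] is passed to the limit in
    [M]. *)
Lemma noise_box_indep m i a b c y : (1 <= m <= N)%N ->
  P (noise_box m.+1 a b c `&` [set t | W m t ord0 i <= y]) =
  (P (noise_box m.+1 a b c) * Phi y)%E.
Proof.
move=> mN.
pose cM (M : nat) (z : R) k j : R :=
  if (k == m) && (j == i) then z else if (m < k)%N then c k j else M%:R.
pose S M z := noise_box 1 a b (cM M z).
have mS M z : measurable (S M z) by exact: measurable_noise_box.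
have PS M : exists K, forall z, P (S M z) = (K * Phi z)%E.
  (* The [0] is a placeholder: away from the coordinate [(m, i)], [cM M z] does not depend on
     [z]. *)
  exists (F a b * ((\prod_(j < d | j != i) Phi (cM M 0%R m j)) *
    \prod_(1 <= k < N.+1 | k != m) \prod_(j < d) Phi (cM M 0%R k j)))%E => z.
  rewrite law (bigD1_seq m) ?iota_uniq//=; last by rewrite mem_index_iota.
  rewrite (bigD1 i)//= {1}/cM !eqxx/= -!muleA; congr (_ * _)%E.
  rewrite muleC -!muleA; congr (_ * _)%E.
    by apply: eq_bigr => j /negbTE ji; rewrite /cM ji andbF.
  congr (_ * _)%E; apply: eq_bigr => k /negbTE km; apply: eq_bigr => j _.
  by rewrite /cM km.
have fP A : measurable A -> P A \is a fin_num by move=> mA; rewrite fin_num_measure.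
(* Crossing the two values of the free coordinate eliminates the unknown
   factor [K], and in particular the unnormalised mass [F a b]. *)
have PSS M : (P (S M y) * Phi M%:R = P (S M M%:R%R) * Phi y)%E.
  by have [K KE] := PS M; rewrite !KE muleAC.
have cM_le M M' z z' k j : (M <= M')%N -> z <= z' -> cM M z k j <= cM M' z' k j.
  move=> MM' zz'; rewrite /cM; case: ifP => // _; case: ifP => // _.
  by rewrite ler_nat.
have S_sub M M' z z' : (M <= M')%N -> z <= z' -> S M z `<=` S M' z'.
  move=> MM' zz' t [h1 h2]; split => // k j kN.
  exact: le_trans (h2 k j kN) (cM_le _ _ _ _ _ _ MM' zz').
have S_box M z t : S M z t -> noise_box m.+1 a b c t /\ W m t ord0 i <= z.
  move=> [h1 h2]; split; last by have := h2 m i mN; rewrite /cM !eqxx.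
  split => // k j /andP[mk kN].
  have := h2 k j; rewrite /cM (gtn_eqF mk)/= mk; apply.
  by rewrite kN andbT (leq_trans _ mk).
have box_S t M z : noise_box m.+1 a b c t -> W m t ord0 i <= z ->
    (forall k j, (k <= N)%N -> `|W k t ord0 j| <= M%:R) -> S M z t.
  move=> [h1 h2] Wz WM; split => // k j /andP[k1 kN]; rewrite /cM.
  case: ifPn => [/andP[/eqP-> /eqP->]//|_].
  case: ifPn => [mk|_]; first by rewrite h2// mk.
  exact: le_trans (ler_norm _) (WM _ _ kN).
have UB : \bigcup_M S M y = noise_box m.+1 a b c `&` [set t | W m t ord0 i <= y].
  apply/seteqP; split => t; first by move=> [M _ /S_box].
  by move=> [Bt Wy]; have [M [_ h2]] := noise_bound t; exists M => //; exact: box_S.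
have UM : \bigcup_M S M M%:R = noise_box m.+1 a b c.
  apply/seteqP; split => t; first by move=> [M _ /S_box[]].
  move=> Bt; have [M [_ h2]] := noise_bound t; exists M => //; apply: box_S => //.
  by apply: le_trans (ler_norm _) (h2 _ _ _); case/andP: mN.
have c1 : P (S M y) @[M --> \oo] -->
    P (noise_box m.+1 a b c `&` [set t | W m t ord0 i <= y]).
  rewrite -UB; apply: nondecreasing_cvg_mu => //.
    exact: bigcupT_measurable.
  by move=> M M' MM'; apply/subsetPset; exact: S_sub.
have c2 : P (S M M%:R) @[M --> \oo] --> P (noise_box m.+1 a b c).
  rewrite -UM; apply: nondecreasing_cvg_mu => //.
    exact: bigcupT_measurable.
  by move=> M M' MM'; apply/subsetPset; apply: S_sub => //; rewrite ler_nat.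
have fB : P (noise_box m.+1 a b c `&` [set t | W m t ord0 i <= y]) \is a fin_num.
  by rewrite -UB fP//; exact: bigcupT_measurable.
have fB' : P (noise_box m.+1 a b c) \is a fin_num by rewrite fP//; exact: measurable_noise_box.
have fy : Phi y \is a fin_num by rewrite fin_num_measure.
have c3 : (P (S M y) * Phi M%:R%R)%E @[M --> \oo] -->
    P (noise_box m.+1 a b c `&` [set t | W m t ord0 i <= y]).
  rewrite -[X in _ --> X]mule1; apply: cvgeM => //; last exact: cvg_Phi.
  by rewrite mule_def_fin.
have c4 : (P (S M y) * Phi M%:R%R)%E @[M --> \oo] -->
    (P (noise_box m.+1 a b c) * Phi y)%E.
  rewrite (_ : (fun M => _) = (fun M => P (S M M%:R%R) * Phi y)%E); last first.
    by apply/funext => M.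
  by apply: cvgeM => //; [rewrite mule_def_fin | exact: cvg_cst].
exact: (cvg_unique _ c3 c4).
Qed.

(* Tonelli: [W m] is independent of [noise_alg m.+1], so the cross term
   [A * W m] disappears even when [A] is not square-integrable. *)
Lemma integral_sqr_noise m i (l : R) (A : noise_alg m.+1 -> R) :
  (1 <= m <= N)%N -> measurable_fun setT A ->
  (\int[P]_t ((A t + l * W m t ord0 i) ^+ 2)%:E =
   \int[P]_t (A t ^+ 2)%:E + (l ^+ 2)%:E)%E.
Proof.
move=> mN mA.
pose f (z : R * R) : \bar R := ((z.1 + l * z.2) ^+ 2)%:E.
have mf : measurable_fun setT f.
  apply/measurable_EFinP; apply: measurable_funX; apply: measurable_funD => //.
  exact: measurable_funM.
have indep : forall B y, noise_boxes m.+1 B ->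
    P (B `&` [set t | W m t ord0 i <= y]) = (P B * Phi y)%E.
  by move=> _ y [a [b [c ->]]]; exact: noise_box_indep.
have mAT := sub_sigma_algebra_measurable_fun (@noise_boxes_measurable m.+1) mA.
rewrite (indep_integral (@noise_boxes_measurable m.+1) (@noise_boxes_setI m.+1)
  (@noise_boxes_cube m.+1) (@noise_cube_cover m.+1) (mW m i) indep mA mf); last first.
  by move=> z; rewrite lee_fin sqr_ge0.
under eq_integral do rewrite /f/= integral_sqr_affine_normal EFinD.
rewrite ge0_integralD//; last 3 first.
- by move=> t _; rewrite lee_fin sqr_ge0.
- by apply/measurable_EFinP; exact: measurable_funX.
- by move=> t _; rewrite lee_fin sqr_ge0.
by rewrite integral_cst// [X in (_ * X)%E](probability_setT P) mule1.
Qed.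

(* All large cubes and the box [a, b] have the same mass [F]; since the former
   exhaust the space, so does the latter. *)
Lemma noise_box_full a b :
  (exists M0 : nat, forall M, (M0 <= M)%N ->
    F (fun=> - M%:R) (fun=> M%:R) = F a b) ->
  P [set t | forall i, a i <= X0 t ord0 i <= b i] = 1%E.
Proof.
move=> [M0 FM].
pose S M := noise_box 1 a b (fun _ _ => M%:R).
have mS M : measurable (S M) by exact: measurable_noise_box.
have US : \bigcup_M S M = [set t | forall i, a i <= X0 t ord0 i <= b i].
  apply/seteqP; split => t; first by move=> [M _ []].
  move=> tab; have [M [_ h2]] := noise_bound t; exists M => //; split => // k i /andP[_ kN].
  exact: le_trans (ler_norm _) (h2 _ _ kN).
have c1 : P (S M) @[M --> \oo] --> P [set t | forall i, a i <= X0 t ord0 i <= b i].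
  rewrite -US; apply: nondecreasing_cvg_mu => //.
    exact: bigcupT_measurable.
  move=> M M' MM'; apply/subsetPset => t [h1 h2]; split => // k j kN.
  by rewrite (le_trans (h2 k j kN))// ler_nat.
have c2 : P (noise_cube 1 M) @[M --> \oo] --> 1%E.
  rewrite -(@probability_setT _ _ _ P) -(noise_cube_cover 1).
  apply: nondecreasing_cvg_mu => //.
  - by move=> M; exact: measurable_noise_box.
  - by apply: bigcupT_measurable => M; exact: measurable_noise_box.
  - move=> M M' MM'; apply/subsetPset => t [h1 h2]; split => [i|k j kN].
      have /andP[l1 l2] := h1 i; rewrite (le_trans _ l1)/=; last by rewrite lerN2 ler_nat.
      by rewrite (le_trans l2)// ler_nat.
    by rewrite (le_trans (h2 k j kN))// ler_nat.
suff c3 : P (S M) @[M --> \oo] --> 1%E by exact: (cvg_unique _ c1 c3).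
(* The cube and [S M] have the same noise bounds, so for [M0 <= M] the law gives them equal
   probability. *)
apply: cvg_trans c2; apply: near_eq_cvg; near=> M.
rewrite /noise_cube /S !law FM//.
by near: M; exact: nbhs_infty_ge.
Unshelve. all: by end_near. Qed.

End gaussian_noises.

(** * Random vectors and affine competitors of the conditional expectation *)

Section random_vectors.
Context {R : realType} (d : nat).

Lemma measurable_coord (i : 'I_d) :
  measurable_fun setT (fun x : Rd R d => x ord0 i).
Proof.
apply: measurable_fun_le_rays => y.
by apply: sub_sigma_algebra; exists i, y.
Qed.

Lemma measurable_fun_Rd dT (T : measurableType dT) (f : T -> 'rV[R]_d) :
  (forall i, measurable_fun setT (fun t => f t ord0 i)) ->
  measurable_fun setT (f : T -> Rd R d).
Proof.
move=> mf; apply: (@measurability _ _ _ (Rd R d) _ _ (@halfspaces R d)) => //.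
move=> _ [_ [i [c ->]] <-].
have -> : f @^-1` [set x : 'rV[R]_d | x ord0 i <= c] =
    (fun t => f t ord0 i) @^-1` `]-oo, c].
  by apply/seteqP; split => t /=; rewrite in_itv.
exact: mf.
Qed.

Lemma sqr_integrable dT (T : measurableType dT) (P : probability T R) (f : T -> R) :
  measurable_fun setT f -> (\int[P]_t (f t ^+ 2)%:E < +oo)%E ->
  P.-integrable setT (EFin \o f).
Proof.
move=> mf f2.
have i2 : P.-integrable setT (fun t => (f t ^+ 2)%:E).
  apply/integrableP; split.
    by apply/measurable_EFinP; exact: measurable_funX.
  by under eq_integral do rewrite gee0_abs ?lee_fin ?sqr_ge0//.
have i1 : P.-integrable setT (cst 1%:E : T -> \bar R).
  exact: finite_measure_integrable_cst.
apply: (le_integrable _ _ _ (integrableD _ i1 i2)) => //.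
  exact/measurable_EFinP.
move=> t _ /=; rewrite lee_fin [leRHS]ger0_norm ?addr_ge0 ?sqr_ge0//.
rewrite -[X in 1 + X]real_normK ?num_real//.
by have := sqr_ge0 (`|f t| - 1 / 2); nra.
Qed.

Lemma cond_exp_affine dT (T : measurableType dT) (P : probability T R)
    (X Y : T -> 'rV[R]_d) (g : 'rV[R]_d -> 'rV[R]_d) i (c e : R) :
  (forall j, measurable_fun setT (fun t => X t ord0 j)) ->
  P.-integrable setT (fun t => (X t ord0 i)%:E) ->
  P.-integrable setT (fun t => (Y t ord0 i)%:E) ->
  is_cond_exp P X Y g ->
  (\int[P]_t ((Y t ord0 i - g (X t) ord0 i) ^+ 2)%:E <=
   \int[P]_t ((Y t ord0 i - (c * X t ord0 i + e)) ^+ 2)%:E)%E.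
Proof.
move=> mX iX iY [mg [ig gE]].
have mX' := measurable_fun_Rd mX.
pose h t := c * X t ord0 i + e.
have ih : P.-integrable setT (fun t => (h t)%:E).
  rewrite (_ : (fun t => _) = (fun t => c%:E * (X t ord0 i)%:E) \+ cst e%:E)%E; last first.
    by apply/funext => t; rewrite /h EFinD EFinM.
  apply: integrableD => //; first exact: integrableZl.
  exact: finite_measure_integrable_cst.
have iB (Z : T -> R) : P.-integrable setT (fun t => (Z t)%:E) ->
    P.-integrable setT (EFin \o (fun t => Z t - h t)).
  move=> iZ; rewrite (_ : _ \o _ = (fun t => (Z t)%:E) \- (fun t => (h t)%:E))%E.
    exact: integrableB.
  by apply/funext => t.
have := cond_exp_projection (iB _ iY) (iB _ (ig i)).
under eq_integral do rewrite opprB addrA subrK.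
apply => S mS.
(* An event of [g (X) - h] is an event of [X], so the defining property of [g] applies to it; [h] is
   then subtracted from both sides. *)
pose A : set (Rd R d) := [set x | S (g x ord0 i - (c * x ord0 i + e))].
have mA : measurable A.
  have mk : measurable_fun setT (fun x : Rd R d => g x ord0 i - (c * x ord0 i + e)).
    apply: measurable_funB.
      exact: (measurableT_comp (measurable_coord i) mg).
    apply: measurable_funD => //; apply: measurable_funM => //.
    exact: measurable_coord.
  by rewrite -[X in measurable X]setTI; exact: mk.
have mXA : measurable (X @^-1` A).
  by rewrite -[X in measurable X]setTI; exact: mX'.
have sub (Z : T -> R) : P.-integrable setT (fun t => (Z t)%:E) ->
    (\int[P]_(t in X @^-1` A) (Z t - h t)%:E =
     \int[P]_(t in X @^-1` A) (Z t)%:E - \int[P]_(t in X @^-1` A) (h t)%:E)%E.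
  move=> iZ; rewrite -integralB//.
  - exact: integrableS iZ.
  - exact: integrableS ih.
change (\int[P]_(t in X @^-1` A) (Y t ord0 i - h t)%:E =
  \int[P]_(t in X @^-1` A) (g (X t) ord0 i - h t)%:E)%E.
by rewrite !sub// gE.
Qed.

End random_vectors.

(** * The forward process *)

Section noise_schedule.
Context {R : realType} (N : nat) (beta : nat -> R).
Hypothesis beta01 : forall k, (1 <= k <= N)%N -> 0 < beta k < 1.

Lemma abar0 : abar beta 0 = 1. Proof. by rewrite /abar big_geq. Qed.

Lemma abarS k : abar beta k.+1 = abar beta k * alpha beta k.+1.
Proof. by rewrite /abar big_nat_recr. Qed.

Lemma alpha_gt0 k : (1 <= k <= N)%N -> 0 < alpha beta k.
Proof. by move=> /beta01/andP[_ b1]; rewrite subr_gt0. Qed.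

Lemma abar_gt0 k : (k <= N)%N -> 0 < abar beta k.
Proof.
elim: k => [|k IHk] kN; first by rewrite abar0.
by rewrite abarS mulr_gt0 ?IHk ?alpha_gt0// ltnW.
Qed.

Lemma abar_le1 k : (k <= N)%N -> abar beta k <= 1.
Proof.
elim: k => [|k IHk] kN; first by rewrite abar0.
rewrite abarS mulr_ile1 ?IHk ?(ltW (abar_gt0 _)) ?ltW ?alpha_gt0//; try exact: ltnW.
by have /andP[b0 _] := beta01 (kN : (1 <= k.+1 <= N)%N); rewrite ltrBlDr ltrDl.
Qed.

Lemma bbar_gt0 k : (1 <= k <= N)%N -> 0 < bbar beta k.
Proof.
case: k => // k /= kN; rewrite subr_gt0 abarS.
have /andP[b0 _] := beta01 (kN : (1 <= k.+1 <= N)%N).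
apply: (@le_lt_trans _ _ (alpha beta k.+1)); last by rewrite ltrBlDr ltrDl.
by rewrite ler_piMl ?(ltW (alpha_gt0 _))// abar_le1// ltnW.
Qed.

Lemma bbar0 : bbar beta 0 = 0. Proof. by rewrite /bbar abar0 subrr. Qed.

End noise_schedule.

Section forward_process.
Context {R : realType} (d N : nat) (beta lambda : nat -> R).
Context dT (T : measurableType dT) (P : probability T R).
Context (X0 : T -> 'rV[R]_d) (W : nat -> T -> 'rV[R]_d).
Context (F : ('I_d -> R) -> ('I_d -> R) -> \bar R).
Hypothesis N1 : (1 <= N)%N.
Hypothesis beta01 : forall k, (1 <= k <= N)%N -> 0 < beta k < 1.
Hypothesis lambdaP : forall k, (1 <= k <= N)%N ->
  0 <= lambda k /\ lambda k ^+ 2 <= bbar beta k.-1.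
Hypothesis mX0 : forall i, measurable_fun setT (fun t => X0 t ord0 i).
Hypothesis mW : forall k i, measurable_fun setT (fun t => W k t ord0 i).
Hypothesis law : forall a b c, P (noise_box N X0 W 1 a b c) =
  (F a b * \prod_(1 <= k < N.+1) \prod_(i < d)
     normal_prob 0 1 `]-oo, c k i]%classic)%E.

Local Notation noise_alg m := (g_sigma_algebraType (noise_boxes N X0 W m)).
Let x k t := fwd beta lambda N (X0 t) (fun j => W j t) k.
Let s n := Num.sqrt (bbar beta n.-1 - lambda n ^+ 2).

Lemma mutildeE n (xn x0 : 'rV[R]_d) i :
  mutilde beta lambda n xn x0 ord0 i =
  Num.sqrt (abar beta n.-1) * x0 ord0 i +
  s n * ((Num.sqrt (bbar beta n))^-1 *
    (xn ord0 i - Num.sqrt (abar beta n) * x0 ord0 i)).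
Proof. by rewrite /mutilde !mxE. Qed.

Lemma fwdN t i : x N t ord0 i =
  Num.sqrt (abar beta N) * X0 t ord0 i + Num.sqrt (bbar beta N) * W N t ord0 i.
Proof. by rewrite /x /fwd gtn_eqF// subnn /= !mxE. Qed.

Lemma fwd_pred n t i : (1 <= n < N)%N -> x n t ord0 i =
  mutilde beta lambda n.+1 (x n.+1 t) (X0 t) ord0 i +
  lambda n.+1 * W n t ord0 i.
Proof.
move=> /andP[n1 nN]; rewrite /x /fwd gtn_eqF//.
have -> : (N - n = (N - n.+1).+1)%N by rewrite subnSK.
by rewrite /= subKn// !mxE.
Qed.

(** The induction follows [fwd_rev], which starts at [N]. It stops at [1] because [fwd] takes [x_0]
    directly from the data. *)
Let downward (Q : nat -> Prop) : Q N ->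
  (forall n, (1 <= n < N)%N -> Q n.+1 -> Q n) ->
  forall n, (1 <= n <= N)%N -> Q n.
Proof.
move=> QN QS n /andP[n1 nN].
rewrite -(subKn nN); move: (leq_subr n N).
have : (N - n < N)%N by rewrite ltn_subrL n1 N1.
elim: (N - n)%N => [|k IHk] kN kN'; first by rewrite subn0.
apply: QS; first by rewrite subn_gt0 kN/= ltn_subrL N1.
by rewrite subnSK//; apply: IHk; exact: ltnW.
Qed.

Lemma noise_alg_mutilde m n (f : T -> 'rV[R]_d) i :
  measurable_fun setT (fun t : noise_alg m => f t ord0 i) ->
  measurable_fun setT
    (fun t : noise_alg m => mutilde beta lambda n (f t) (X0 t) ord0 i).
Proof.
move=> mf.
have mX : measurable_fun setT (fun t : noise_alg m => X0 t ord0 i).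
  exact: noise_alg_X0.
rewrite (_ : (fun t => _) = (fun t : noise_alg m =>
  Num.sqrt (abar beta n.-1) * X0 t ord0 i +
  s n * ((Num.sqrt (bbar beta n))^-1 *
    (f t ord0 i - Num.sqrt (abar beta n) * X0 t ord0 i)))); last first.
  by apply/funext => t; exact: mutildeE.
apply: measurable_funD; first exact: measurable_funM.
do 2 apply: measurable_funM => //.
by apply: measurable_funB => //; exact: measurable_funM.
Qed.

(* Stated for every [m <= n] since [noise_alg m] contains [noise_alg n]. *)
Lemma noise_alg_fwd n : (1 <= n <= N)%N -> forall m i, (m <= n)%N ->
  measurable_fun setT (fun t : noise_alg m => x n t ord0 i).
Proof.
move: n; apply: downward => [m i mN|n /andP[n1 nN] IHn m i mn].
  rewrite (_ : (fun t => _) = (fun t : noise_alg m =>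
      Num.sqrt (abar beta N) * X0 t ord0 i +
      Num.sqrt (bbar beta N) * W N t ord0 i)); last first.
    by apply/funext => t; exact: fwdN.
  apply: measurable_funD; apply: measurable_funM => //.
    exact: noise_alg_X0.
  by apply: noise_alg_W; rewrite mN leqnn.
rewrite (_ : (fun t => _) = (fun t : noise_alg m =>
    mutilde beta lambda n.+1 (x n.+1 t) (X0 t) ord0 i +
    lambda n.+1 * W n t ord0 i)); last first.
  by apply/funext => t; rewrite fwd_pred// n1.
apply: measurable_funD.
  by apply: noise_alg_mutilde; apply: IHn; rewrite leqW.
apply: measurable_funM => //; apply: noise_alg_W.
by rewrite mn ltnW.
Qed.

Lemma measurable_fwd n i : (n <= N)%N ->
  measurable_fun setT (fun t => x n t ord0 i).
Proof.
case: n => [_|n nN]; first exact: mX0.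
apply: (sub_sigma_algebra_measurable_fun (noise_boxes_measurable (m := 0) mX0 mW)).
exact: noise_alg_fwd.
Qed.

Lemma integral_scale_sqr (c : R) (f : T -> R) : measurable_fun setT f ->
  (\int[P]_t ((c * f t) ^+ 2)%:E = (c ^+ 2)%:E * \int[P]_t (f t ^+ 2)%:E)%E.
Proof.
move=> mf; under eq_integral do rewrite exprMn EFinM.
rewrite ge0_integralZl_EFin ?sqr_ge0//.
- by move=> t _; rewrite lee_fin sqr_ge0.
- by apply/measurable_EFinP; exact: measurable_funX.
Qed.

(** The residual at [n] is [c] times the one at [n + 1] plus the fresh noise [lambda_{n+1} w_n],
    with [c^2 = (bbar_n - lambda_{n+1}^2) / bbar_{n+1}]. The radicand in [mutilde] is exactly what
    makes the two variances add up to [bbar_n]. *)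
Lemma fwd_residual_variance n i : (1 <= n <= N)%N ->
  (\int[P]_t ((x n t ord0 i - Num.sqrt (abar beta n) * X0 t ord0 i) ^+ 2)%:E =
   (bbar beta n)%:E)%E.
Proof.
move: n; apply: downward => [|n nN IHn].
  have NN : (1 <= N <= N)%N by rewrite N1 leqnn.
  transitivity (\int[P]_t ((cst 0 t + Num.sqrt (bbar beta N) * W N t ord0 i) ^+ 2)%:E)%E.
    by apply: eq_integral => t _; rewrite fwdN addrAC subrr.
  rewrite (integral_sqr_noise mX0 mW law)//.
  under eq_integral do rewrite /= expr0n/=.
  by rewrite integral0 add0e sqr_sqrtr// ltW// (bbar_gt0 beta01).
have /andP[n1 nN'] := nN.
have nN1 : (1 <= n.+1 <= N)%N by [].
pose D t := x n.+1 t ord0 i - Num.sqrt (abar beta n.+1) * X0 t ord0 i.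
have mD : measurable_fun setT (D : noise_alg n.+1 -> R).
  apply: measurable_funB; first exact: noise_alg_fwd.
  by apply: measurable_funM => //; exact: noise_alg_X0.
have mDT : measurable_fun setT D.
  exact: (sub_sigma_algebra_measurable_fun 
    (noise_boxes_measurable (m := n.+1) mX0 mW) mD).
pose c := s n.+1 / Num.sqrt (bbar beta n.+1).
transitivity (\int[P]_t ((c * D t + lambda n.+1 * W n t ord0 i) ^+ 2)%:E)%E.
  apply: eq_integral => t _; rewrite fwd_pred// mutildeE /c /D/=.
  by congr ((_ ^+ 2)%:E); ring.
rewrite (integral_sqr_noise mX0 mW law); last 2 first.
- by rewrite n1 ltnW.
- exact: measurable_funM.
rewrite integral_scale_sqr// IHn -EFinM -EFinD; congr EFin.
have [_ l2] := lambdaP nN1.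
rewrite /c expr_div_n sqr_sqrtr ?subr_ge0// sqr_sqrtr ?(ltW (bbar_gt0 beta01 _))//.
by rewrite divfK ?gt_eqF ?(bbar_gt0 beta01)//= subrK.
Qed.

Lemma fwd_step_variance n i (Z : noise_alg n -> R) : (1 <= n <= N)%N ->
  measurable_fun setT Z ->
  (\int[P]_t ((x n.-1 t ord0 i - Z t) ^+ 2)%:E =
   \int[P]_t ((mutilde beta lambda n (x n t) (X0 t) ord0 i - Z t) ^+ 2)%:E
   + (lambda n ^+ 2)%:E)%E.
Proof.
case: n Z => // -[|n] Z nN mZ /=.
  (* The step to [x_0] adds no noise: [bbar_0 = 0] forces [lambda_1 = 0], and [mutilde_1] returns
     [x_0] itself. *)
  have [_ /=] := lambdaP nN; rewrite bbar0 => l2.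
  have l0 : lambda 1%N ^+ 2 = 0 by apply/eqP; rewrite eq_le l2 sqr_ge0.
  rewrite l0 adde0; apply: eq_integral => t _; rewrite mutildeE/= /s/= abar0 bbar0 l0.
  by rewrite subr0 sqrtr0 mul0r addr0 sqrtr1 mul1r /x /fwd.
transitivity (\int[P]_t ((mutilde beta lambda n.+2 (x n.+2 t) (X0 t) ord0 i - Z t
    + lambda n.+2 * W n.+1 t ord0 i) ^+ 2)%:E)%E.
  by apply: eq_integral => t _; rewrite fwd_pred// addrAC.
apply: (integral_sqr_noise mX0 mW law); first exact: ltnW.
apply: measurable_funB => //; apply: noise_alg_mutilde.
exact: noise_alg_fwd.
Qed.

(** * Coordinatewise bounds on the reverse variance *)

Section reverse_variance.
Context (n : nat) (g : 'rV[R]_d -> 'rV[R]_d).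
Hypothesis nN : (1 <= n <= N)%N.
Hypothesis X02 : forall i, P.-integrable setT (fun t => (X0 t ord0 i ^+ 2)%:E).
Hypothesis gP : is_cond_exp P (x n) (x n.-1) g.

Let err i := (\int[P]_t ((x n.-1 t ord0 i - g (x n t) ord0 i) ^+ 2)%:E)%E.

Let nN' : (n <= N)%N. Proof. by case/andP: nN. Qed.
Let n1N : (n.-1 <= N)%N. Proof. exact: leq_trans (leq_pred _) nN'. Qed.

Lemma integrable_X0 i : P.-integrable setT (fun t => (X0 t ord0 i)%:E).
Proof.
apply: (@sqr_integrable _ _ _ P (fun t => X0 t ord0 i)) => //.
have /integrableP[_] := X02 i.
by under eq_integral do rewrite gee0_abs ?lee_fin ?sqr_ge0//.
Qed.

(** For [k >= 1], [x_k] is its residual, of finite variance, plus a multiple of the integrable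
    [x_0]. *)
Lemma integrable_fwd k i : (k <= N)%N ->
  P.-integrable setT (fun t => (x k t ord0 i)%:E).
Proof.
case: k => [_|k kN]; first exact: integrable_X0.
rewrite (_ : (fun t => _) = (fun t =>
    (x k.+1 t ord0 i - Num.sqrt (abar beta k.+1) * X0 t ord0 i)%:E) \+
    (fun t => (Num.sqrt (abar beta k.+1))%:E * (X0 t ord0 i)%:E))%E; last first.
  by apply/funext => t /=; rewrite -EFinM -EFinD subrK.
apply: integrableD => //; last by apply: integrableZl => //; exact: integrable_X0.
apply: (@sqr_integrable _ _ _ P
  (fun t => x k.+1 t ord0 i - Num.sqrt (abar beta k.+1) * X0 t ord0 i)).
  by apply: measurable_funB; [exact: measurable_fwd | exact: measurable_funM].
by rewrite fwd_residual_variance// ltry.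
Qed.

Lemma reverse_variance_ge i : ((lambda n ^+ 2)%:E <= err i)%E.
Proof.
rewrite /err (@fwd_step_variance n i (fun t => g (x n t) ord0 i))//.
  by rewrite leeDr// integral_ge0// => t _; rewrite lee_fin sqr_ge0.
have [mg _] := gP.
apply: (measurableT_comp (measurable_coord i)).
apply: (measurableT_comp mg).
by apply: measurable_fun_Rd => j; exact: noise_alg_fwd.
Qed.

Lemma reverse_variance_le i (c e : R) :
  (err i <= \int[P]_t ((mutilde beta lambda n (x n t) (X0 t) ord0 i -
     (c * x n t ord0 i + e)) ^+ 2)%:E + (lambda n ^+ 2)%:E)%E.
Proof.
rewrite -(@fwd_step_variance n i (fun t => c * x n t ord0 i + e))//.
  apply: cond_exp_affine => //.
  - by move=> j; exact: measurable_fwd.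
  - exact: integrable_fwd.
  - exact: integrable_fwd.
apply: measurable_funD => //; apply: measurable_funM => //.
exact: noise_alg_fwd.
Qed.

Lemma reverse_variance_le_linear i :
  (err i <= (lambda n ^+ 2 +
     (Num.sqrt (bbar beta n / alpha beta n) - s n) ^+ 2)%:E)%E.
Proof.
pose c := (Num.sqrt (alpha beta n))^-1.
pose b := Num.sqrt (bbar beta n).
have an0 : 0 < alpha beta n by exact: alpha_gt0 beta01 _ nN.
have bn0 : 0 < bbar beta n by exact: bbar_gt0 beta01 _ nN.
have b0 : b != 0 by rewrite gt_eqF ?sqrtr_gt0.
apply: le_trans (reverse_variance_le i c 0) _.
(* This identity dictates [c]: [c x_n] then has the same [x_0] part as [mutilde], and only the
   residual survives in the difference. *)
have abn : Num.sqrt (abar beta n) * c = Num.sqrt (abar beta n.-1).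
  move: nN an0; rewrite /c; case: n => // m mN am.
  rewrite abarS sqrtrM ?(ltW (abar_gt0 beta01 _)) ?mulfK//=.
    by rewrite gt_eqF ?sqrtr_gt0.
  by case/andP: mN => _ /ltnW.
under eq_integral => t _.
  rewrite mutildeE (_ : _ - _ = (s n / b - c) *
     (x n t ord0 i - Num.sqrt (abar beta n) * X0 t ord0 i)); last first.
    by rewrite -abn /b; ring.
  over.
rewrite integral_scale_sqr; last first.
  by apply: measurable_funB; [exact: measurable_fwd | exact: measurable_funM].
rewrite fwd_residual_variance// -EFinM -EFinD lee_fin addrC lerD2l.
rewrite -[X in _ * X](sqr_sqrtr (ltW bn0)) -exprMn -/b mulrBl divfK//.
rewrite sqrtrM ?(ltW bn0)// sqrtrV ?(ltW an0)// -/b -/c -[leRHS]sqrrN opprB.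
by rewrite mulrC.
Qed.

Lemma reverse_variance_le_bounded i (a b : R) :
  P [set t | forall j, a <= X0 t ord0 j <= b] = 1%E ->
  (err i <= (lambda n ^+ 2 +
     (Num.sqrt (abar beta n.-1) - s n * Num.sqrt (abar beta n / bbar beta n)) ^+ 2
     * ((b - a) / 2) ^+ 2)%:E)%E.
Proof.
move=> Pab.
(* [k] is the total coefficient of [x_0] in [mutilde], with [x_n] held fixed. Putting the centre [m]
   for [x_0] gives slope [s n / sqrt(bbar_n)] and intercept [k * m]. *)
pose k := Num.sqrt (abar beta n.-1) - s n * Num.sqrt (abar beta n / bbar beta n).
pose m := (a + b) / 2.
have bn0 : 0 < bbar beta n by exact: bbar_gt0 beta01 _ nN.
apply: le_trans (reverse_variance_le i (s n / Num.sqrt (bbar beta n)) (k * m)) _.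
under eq_integral => t _.
  rewrite mutildeE (_ : _ - _ = k * (X0 t ord0 i - m)); last first.
    rewrite /k sqrtrM ?(ltW (abar_gt0 beta01 _))// sqrtrV ?(ltW bn0)//; ring.
  over.
rewrite integral_scale_sqr; last exact: measurable_funB.
rewrite [X in (_ <= X%:E)%E]addrC EFinD; apply: leeD => //.
rewrite [leRHS]EFinM; apply: lee_wpmul2l; first by rewrite lee_fin sqr_ge0.
set B := [set t | _] in Pab.
have mB : measurable B.
  (* From [N.+1] on there is no noise left to constrain, so [B] is itself a box. *)
  have -> : B = noise_box N X0 W N.+1 (fun=> a) (fun=> b) (fun _ _ => 0).
    apply/seteqP; split => t; last by case.
    by split => // j l /andP[Nj jN]; move: (leq_trans Nj jN); rewrite ltnn.
  exact: measurable_noise_box.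
apply: (@le_trans _ _ (\int[P]_t (((b - a) / 2) ^+ 2)%:E)%E); last first.
  by rewrite integral_cst// [X in (_ * X)%E](probability_setT P) mule1.
apply: ae_ge0_le_integral => //.
- by move=> t _; rewrite lee_fin sqr_ge0.
- by apply/measurable_EFinP; apply: measurable_funX; exact: measurable_funB.
- by move=> t _; rewrite lee_fin sqr_ge0.
exists (~` B); split; first exact: measurableC.
  by apply: (etrans (probability_setC P mB)); rewrite Pab subee.
move=> t /=; apply: contra_not => /(_ i)/andP[ax xb] _.
rewrite lee_fin /m; nra.
Qed.

End reverse_variance.
End forward_process.

Theorem theorem2 (R : realType) (d N : nat) (beta lambda : nat -> R)
  (dT : measure_display) (T : measurableType dT) (P : probability T R)
  (q : 'rV[R]_d -> R) (X0 : T -> 'rV[R]_d) (W : nat -> T -> 'rV[R]_d)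
  (n : nat) :
  (1 <= d)%N -> (1 <= N)%N ->
  (forall k, (1 <= k <= N)%N -> 0 < beta k < 1) ->
  (forall k, (1 <= k <= N)%N ->
     0 <= lambda k /\ lambda k ^+ 2 <= bbar beta k.-1) ->
  (* q is a probability density on R^d (Lebesgue-a.e. defined, Borel) *)
  (forall x, 0 <= q x) ->
  @measurable_fun _ _ (Rd R d) R setT q ->
  (* measurability of the data x_0 and of the noises *)
  (forall i, measurable_fun setT (fun t => X0 t ord0 i)) ->
  (forall k i, measurable_fun setT (fun t => W k t ord0 i)) ->
  (* joint law: x_0 ~ q, w_1..w_N ~ N(0, I_d), all independent *)
  (forall (a b : 'I_d -> R) (c : nat -> 'I_d -> R),
     P [set t | (forall i, a i <= X0 t ord0 i <= b i) /\
                (forall k i, (1 <= k <= N)%N -> W k t ord0 i <= c k i)] =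
     (iint (fun x : 'rV[R]_d =>
        (q x * \1_[set y : 'rV[R]_d | forall i, a i <= y ord0 i <= b i] x)%:E)
      * \prod_(1 <= k < N.+1) \prod_(i < d)
          normal_prob 0 1 `]-oo, c k i])%E) ->
  (* finite second moments *)
  (forall i, P.-integrable setT (fun t => (X0 t ord0 i ^+ 2)%:E)) ->
  (1 <= n <= N)%N ->
  let x k := fun t => fwd beta lambda N (X0 t) (fun j => W j t) k in
  forall g : 'rV[R]_d -> 'rV[R]_d,
  is_cond_exp P (x n) (x n.-1) g ->
  let sigma2 := (((d%:R)^-1)%:E * exp_tr_cond_cov P (x n) (x n.-1) g)%E in
  ((lambda n ^+ 2)%:E <= sigma2 /\
   sigma2 <= (lambda n ^+ 2 +
     (Num.sqrt (bbar beta n / alpha beta n)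
      - Num.sqrt (bbar beta n.-1 - lambda n ^+ 2)) ^+ 2)%:E /\
   (forall a b : R,
     (forall x : 'rV[R]_d, q x != 0 -> forall i, a <= x ord0 i <= b)%R ->
     sigma2 <= (lambda n ^+ 2 +
       (Num.sqrt (abar beta n.-1)
        - Num.sqrt (bbar beta n.-1 - lambda n ^+ 2)
          * Num.sqrt (abar beta n / bbar beta n)) ^+ 2
       * ((b - a) / 2) ^+ 2)%:E))%E.
Proof.
move=> d1 N1 beta01 lambdaP q0 mq mX0 mW law X02 nN x g gP sigma2.
pose F (a b : 'I_d -> R) := iint (fun y : 'rV[R]_d =>
  (q y * \1_[set y : 'rV[R]_d | forall i, a i <= y ord0 i <= b i] y)%:E).
pose err i := (\int[P]_t ((x n.-1 t ord0 i - g (x n t) ord0 i) ^+ 2)%:E)%E.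
have law' a b c : P (noise_box N X0 W 1 a b c) =
    (F a b * \prod_(1 <= k < N.+1) \prod_(i < d)
       normal_prob 0 1 `]-oo, c k i]%classic)%E by exact: law.
have [mg [ig _]] := gP.
have nN' : (n <= N)%N by case/andP: nN.
have mx k i : (k <= N)%N -> measurable_fun setT (fun t => x k t ord0 i).
  exact: (measurable_fwd beta lambda N1 mX0 mW).
have d0 : (0 : R) < d%:R by rewrite ltr0n.
(* [sigma2] is the average of the coordinate errors, so a bound common to all coordinates passes to
   it. *)
have sigmaE : sigma2 = ((d%:R^-1)%:E * \sum_(i < d) err i)%E.
  rewrite /sigma2 /exp_tr_cond_cov; congr (_ * _)%E.
  under eq_integral do rewrite -sumEFin.
  rewrite ge0_integral_sum//.
  - move=> i; apply/measurable_EFinP; apply: measurable_funX.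
    apply: measurable_funB; first by apply: mx; exact: leq_trans (leq_pred _) nN'.
    by apply/measurable_EFinP; exact: measurable_int (ig i).
  - by move=> i t _; rewrite lee_fin sqr_ge0.
have avg (c : R) : ((d%:R^-1)%:E * \sum_(i < d) c%:E = c%:E)%E.
  rewrite sumEFin -EFinM; congr EFin.
  by rewrite sumr_const card_ord -[X in _ * X]mulr_natl mulKf// gt_eqF.
have avg_le (u v : 'I_d -> \bar R) : (forall i, u i <= v i)%E ->
    ((d%:R^-1)%:E * \sum_(i < d) u i <= (d%:R^-1)%:E * \sum_(i < d) v i)%E.
  move=> uv; apply: lee_wpmul2l; first by rewrite lee_fin invr_ge0 ltW.
  by apply: lee_sum => i _.
rewrite sigmaE; split; [|split].
- rewrite -[leLHS]avg; apply: avg_le => i.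
  exact: (reverse_variance_ge N1 lambdaP mX0 mW law' nN gP).
- rewrite -[leRHS]avg; apply: avg_le => i.
  exact: (reverse_variance_le_linear N1 beta01 lambdaP mX0 mW law' nN X02 gP).
move=> a b qab; rewrite -[leRHS]avg; apply: avg_le => i.
apply: (reverse_variance_le_bounded N1 beta01 lambdaP mX0 mW law' nN X02 gP).
apply: (noise_box_full (N := N) (W := W) (F := F) mX0 mW law' (a := fun=> a) (b := fun=> b)).
(* From here on the cube contains [[a, b]^d], outside which [q] vanishes. Both integrands then equal
   [q] pointwise, so the iterated integrals agree. *)
exists (Num.truncn (Num.max `|a| `|b|)).+1 => M truncM.
have /ltW : Num.max `|a| `|b| < M%:R.
  by apply: lt_le_trans (truncnS_gt _) _; rewrite ler_nat.
rewrite ge_max => /andP[aM bM].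
congr iint; apply/funext => y; congr EFin.
have [->|qy] := eqVneq (q y) 0; first by rewrite !mul0r.
congr (_ * _); rewrite !indicE; congr (_ %:R); congr nat_of_bool.
apply/idP/idP => _; rewrite inE/= => j; have /andP[ay yb] := qab y qy j.
  by rewrite ay yb.
move: aM bM; rewrite !ler_norml => /andP[Ma _] /andP[_ bM].
by rewrite (le_trans Ma ay) (le_trans yb bM).
Qed.
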